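(* For every integer $r\ge 3$ and every $\gamma>0$ there exist $\varepsilon>0$ and $n_0\in\mathbb{N}$ such that for every graph $G$ on $n\ge n_0$ vertices with a proper edge coloring $\chi$ the following is true. If \[ \phi_{\chi}^R(G,K_r)\ge \mathrm{ex}(n,K_r)-\varepsilon n^2, \] then there exists a partition $V(G)=V_1\,\dot\cup\,\cdots\,\dot\cup\, V_{r-1}$ with $\sum_{i=1}^{r-1}e(V_i)<\gamma n^2$.
   Context: All graphs are finite and simple. A proper edge coloring of $G$ assigns a color to every edge so that any two edges sharing a vertex receive distinct colors (any number of colors is allowed). A copy of a graph $H$ in $G$ is rainbow (under $\chi$) if all its edges have pairwise distinct colors. For a graph $G$ with a proper edge coloring $\chi$ and a graph $H$, a rainbow $H$-decomposition of $G$ is a partition of $E(G)$ into parts $G_1,\dots,G_t$ such that each $G_i$ is either a single edge or is a rainbow subgraph isomorphic to $H$; $\phi_{\chi}^R(G,H)$ denotes the smallest possible $t$. Equivalently $\phi_\chi^R(G,H)=e(G)-(e(H)-1)N_\chi^R(G,H)$, where $N_\chi^R(G,H)$ is the maximum number of pairwise edge-disjoint rainbow copies of $H$ in $G$ under $\chi$. $\mathrm{ex}(n,H)$ is the maximum number of edges in a graph on $n$ vertices that does not contain $H$ as a (not necessarily induced) subgraph. For $U\subseteq V(G)$, $e(U)$ is the number of edges of $G$ with both endpoints in $U$. *)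

(* Defs.v *)
From mathcomp Require Import all_boot.

Set Implicit Arguments.
Unset Strict Implicit.
Unset Printing Implicit Defensive.

(* A finite simple graph with vertex type [T] is given by its edge set, a set
   of 2-element subsets of [T]; adjacency of x and y is [[set x; y] \in E]. *)
Definition is_sgraph (T : finType) (E : {set {set T}}) : bool :=
  [forall A in E, #|A| == 2].

Definition complete_graph (r : nat) : {set {set 'I_r}} :=
  [set A : {set 'I_r} | #|A| == 2].

(* [D] is the edge set of a copy of the graph [H] on the vertex type [T];
   whether [D] is induced in an ambient graph is irrelevant. *)
Definition is_copy (U T : finType) (H : {set {set U}}) (D : {set {set T}}) :
    bool :=
  [exists f : {ffun U -> T},
     injectiveb f && (D == [set [set f x | x in A] | A : {set U} in H])].

Definition is_free (U T : finType) (H : {set {set U}}) (E : {set {set T}}) :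
    bool :=
  ~~ [exists D : {set {set T}}, (D \subset E) && is_copy H D].

(* ex(n, H). *)
Definition turan_number (U : finType) (n : nat) (H : {set {set U}}) : nat :=
  \max_(E : {set {set 'I_n}} | is_sgraph E && is_free H E) #|E|.

(* An edge coloring is a total function on sets of vertices; only its values
   on edges matter. *)
Definition proper_edge_coloring (T : finType) (C : eqType) (E : {set {set T}})
    (chi : {set T} -> C) : Prop :=
  {in E &, forall A B : {set T},
     A != B -> A :&: B != set0 -> chi A != chi B}.

Definition rainbow (T : finType) (C : eqType) (chi : {set T} -> C)
    (D : {set {set T}}) : bool :=
  dinjectiveb chi D.

Definition rainbow_decomposition (U T : finType) (C : eqType)
    (E : {set {set T}}) (chi : {set T} -> C) (H : {set {set U}})
    (P : {set {set {set T}}}) : bool :=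
  partition P E &&
  [forall D in P, (#|D| == 1) || (is_copy H D && rainbow chi D)].

Definition singletons (T : finType) (E : {set {set T}}) : {set {set {set T}}} :=
  [set [set A] | A in E].

(* The least number of parts of a rainbow [H]-decomposition; the minimum is
   over a nonempty family since it contains [singletons E]. *)
Definition rainbow_phi (U T : finType) (C : eqType) (E : {set {set T}})
    (chi : {set T} -> C) (H : {set {set U}}) : nat :=
  #|[arg min_(P < singletons E | rainbow_decomposition E chi H P) #|P|]|.

Definition edges_within (T : finType) (E : {set {set T}}) (V : {set T}) : nat :=
  #|[set A in E | A \subset V]|.

(* The parts are indexed and may be empty. *)
Definition vertex_partition (T : finType) (k : nat) (V : 'I_k -> {set T}) :
    Prop :=
  (\bigcup_(i < k) V i = [set: T]) /\
  (forall i j : 'I_k, i != j -> [disjoint V i & V j]).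

Lemma singletons_decomposition (U T : finType) (C : eqType)
    (E : {set {set T}}) (chi : {set T} -> C) (H : {set {set U}}) :
  rainbow_decomposition E chi H (singletons E).
Proof.
apply/andP; split; last first.
  by apply/forall_inP => D /imsetP[A _ ->]; rewrite cards1.
apply/and3P; split.
- apply/eqP/setP => A; apply/bigcupP/idP => [[_ /imsetP[B EB ->]]|EA].
    by rewrite inE => /eqP ->.
  by exists [set A]; rewrite ?set11 //; apply: imset_f.
- apply/trivIsetP => _ _ /imsetP[A _ ->] /imsetP[B _ ->] neAB.
  by rewrite disjoints1 inE; apply: contra neAB => /eqP ->.
- by apply/imsetP => -[A _] /setP/(_ A); rewrite !inE eqxx.
Qed.

Lemma rainbow_phi_attained (U T : finType) (C : eqType)
    (E : {set {set T}}) (chi : {set T} -> C) (H : {set {set U}}) :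
  exists2 P, rainbow_decomposition E chi H P & #|P| = rainbow_phi E chi H.
Proof.
rewrite /rainbow_phi.
case: arg_minnP => [|P HP _]; first exact: singletons_decomposition.
by exists P.
Qed.

Lemma rainbow_phi_le (U T : finType) (C : eqType)
    (E : {set {set T}}) (chi : {set T} -> C) (H : {set {set U}})
    (P : {set {set {set T}}}) :
  rainbow_decomposition E chi H P -> rainbow_phi E chi H <= #|P|.
Proof.
rewrite /rainbow_phi => HP.
case: arg_minnP => [|Q _]; first exact: singletons_decomposition.
exact.
Qed.

(* Main.v *)
Require Import Defs.
From mathcomp Require Import all_boot all_order all_algebra reals.
From mathcomp Require Import zify.
Import Order.TTheory GRing.Theory Num.Theory.
Set Implicit Arguments.
Unset Strict Implicit.
Unset Printing Implicit Defensive.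

(* Write r = q + 1, c = C(r, 2) - 1 and tau = (q - 1) / (2 q).  Every properly
   colored graph with m vertices and e edges contains k edge-disjoint rainbow
   r-cliques with e <= tau m^2 + lambda c k + O(m) for a fixed lambda < 1: as in
   Bollobás' decomposition theorem, delete a vertex x of minimum degree together
   with cliques whose traces on the neighborhood of x are disjoint.  For r > 3
   greedy cliques suffice; for r = 3 one takes a matching in the neighborhood,
   except in a nearly complete graph, where the triangles are found directly.
   Since phi <= e - c k, a value of phi close to the Turán number forces k to be
   o(n^2), and then deleting a maximal packing costs only o(n^2) edges and leaves
   a graph without rainbow r-cliques and with tau n^2 - o(n^2) edges.  Füredi's
   degree argument shows that such a graph is nearly q-partite: it survives the
   passage to rainbow cliques because, by properness, only boundedly many
   vertices fail to extend a given rainbow clique. *)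

(** * Rainbow cliques and edge-disjoint packings *)

Section Packings.
Variable T : finType.
Implicit Types (E F : {set {set T}}) (A B K W : {set T}) (u v x y : T).

Definition pairs W : {set {set T}} := [set A : {set T} | A \subset W & #|A| == 2].

Definition nb E v : {set T} := [set y | [set v; y] \in E].

Lemma card_pairs W : #|pairs W| = 'C(#|W|, 2).
Proof. exact: cards_draws. Qed.

Lemma pairsP W A :
  reflect (exists x y, [/\ x \in W, y \in W, x != y & A = [set x; y]])
          (A \in pairs W).
Proof.
rewrite inE; apply: (iffP andP) => [[sAW /cards2P[x [y [neq_xy defA]]]]|].
  by exists x, y; split; rewrite // (subsetP sAW) // defA !inE eqxx ?orbT.
move=> [x [y [Wx Wy neq_xy ->]]]; rewrite cards2 neq_xy; split=> //.
by apply/subsetP => z; rewrite !inE => /orP[]/eqP->.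
Qed.

Lemma mem_pairs2 W x y :
  ([set x; y] \in pairs W) = [&& x \in W, y \in W & x != y].
Proof.
rewrite inE cards2 subUset !sub1set -andbA; case: (x \in W) => //=.
by case: (y \in W) => //=; case: (x == y).
Qed.

Lemma pairsS A B : A \subset B -> pairs A \subset pairs B.
Proof.
by move=> sAB; apply/subsetP => e; rewrite !inE => /andP[/subset_trans->].
Qed.

Lemma set2_other A x : #|A| = 2 -> x \in A -> exists2 y, y != x & A = [set x; y].
Proof.
move/eqP/cards2P => [a [b [neq_ab ->]]]; rewrite !inE => /orP[]/eqP->.
  by exists b; rewrite // eq_sym.
by exists a; rewrite // setUC.
Qed.

Lemma nb_sym E x y : (y \in nb E x) = (x \in nb E y).
Proof. by rewrite !inE setUC. Qed.

Lemma nb_irr W E v : E \subset pairs W -> v \notin nb E v.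
Proof.
move=> sEW; rewrite inE; apply/negP => /(subsetP sEW).
by rewrite mem_pairs2 eqxx !andbF.
Qed.

Lemma nb_sub W E v : E \subset pairs W -> nb E v \subset W.
Proof.
move=> sEW; apply/subsetP => y; rewrite inE => /(subsetP sEW).
by rewrite mem_pairs2 => /and3P[].
Qed.

Lemma card_incident W E A v : E \subset pairs W -> v \in A ->
  #|[set e in E | (e \subset A) && (v \in e)]| = #|nb E v :&: A|.
Proof.
move=> sEW Av.
rewrite -(@card_in_imset _ _ (fun y => [set v; y]) (mem (nb E v :&: A))).
  apply: eq_card => e; rewrite inE; apply/and3P/imsetP.
    move=> [Ee sA ve]; have: e \in pairs W by apply: (subsetP sEW).
    rewrite inE => /andP[_ /eqP e2]; have [y neq_y defe] := set2_other e2 ve.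
    exists y => //; rewrite !inE -defe Ee.
    by apply: (subsetP sA); rewrite defe !inE eqxx orbT.
  move=> [y]; rewrite !inE => /andP[Ee Ay] ->; split=> //; last by rewrite set21.
  by rewrite subUset !sub1set Av.
move=> y z; rewrite !inE => /andP[Ey _] /andP[Ez _] eq_yz.
have nyv : y != v.
  by apply: contraTneq (subsetP sEW _ Ey) => ->; rewrite mem_pairs2 eqxx !andbF.
have : y \in [set v; z] by rewrite -eq_yz set22.
by rewrite !inE (negPf nyv) => /eqP.
Qed.

Variables (C : eqType) (chi : {set T} -> C).

Definition rainbow_clique E K := (pairs K \subset E) && rainbow chi (pairs K).

(** Copies are recorded by their vertex sets, so edge-disjointness is disjointness of [pairs]: two
    members may still share one vertex. *)
Definition packing (r : nat) E (Q : {set {set T}}) : Prop :=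
  {in Q, forall K, #|K| = r /\ rainbow_clique E K} /\
  {in Q &, forall K K', K != K' -> [disjoint pairs K & pairs K']}.

Lemma rainbow_cliqueS E F K :
  E \subset F -> rainbow_clique E K -> rainbow_clique F K.
Proof. by move=> sEF /andP[/subset_trans sK rK]; rewrite /rainbow_clique sK. Qed.

Lemma packing0 r E : packing r E set0.
Proof. by split=> [K|K K']; rewrite inE. Qed.

Lemma packingU r E1 E2 E Q1 Q2 : 1 < r ->
    E1 \subset E -> E2 \subset E -> [disjoint E1 & E2] ->
    packing r E1 Q1 -> packing r E2 Q2 ->
  packing r E (Q1 :|: Q2) /\ #|Q1 :|: Q2| = #|Q1| + #|Q2|.
Proof.
move=> r_gt1 sE1 sE2 dE P1 P2; have [Q1E Q1d] := P1; have [Q2E Q2d] := P2.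
have d12 K K' : K \in Q1 -> K' \in Q2 -> [disjoint pairs K & pairs K'].
  move=> /Q1E[_ /andP[sK _]] /Q2E[_ /andP[sK' _]].
  exact: disjointWl sK (disjointWr sK' dE).
split.
  split=> [K|K K'].
    case/setUP => [/Q1E|/Q2E] [-> rK]; split=> //; exact: rainbow_cliqueS rK.
  case/setUP => QK /setUP[]QK' neqK; [exact: Q1d|exact: d12| |exact: Q2d].
  by rewrite disjoint_sym; apply: d12.
(* A common member would have a set of pairs disjoint from itself, yet nonempty since [1 < r]. *)
apply/eqP; rewrite (leq_card_setU Q1 Q2).2; apply/pred0P => K /=.
apply/negP => /andP[K1 K2]; have := d12 K K K1 K2.
have [cK _] := Q1E K K1.
by rewrite -setI_eq0 setIid -cards_eq0 card_pairs cK eqn0Ngt bin_gt0 r_gt1.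
Qed.

Lemma card_cover_pairs r (Q : {set {set T}}) : {in Q, forall K, #|K| = r} ->
  #|\bigcup_(K in Q) pairs K| <= #|Q| * 'C(r, 2).
Proof.
move=> Qr; rewrite -sum_nat_const.
have -> : \sum_(K in Q) 'C(r, 2) = \sum_(K in Q) #|pairs K|.
  by apply: eq_bigr => K /Qr cK; rewrite card_pairs cK.
elim/big_rec2: _ => [|K n A _ IH]; first by rewrite cards0.
exact: leq_trans (leq_card_setU _ _) (leq_add _ _).
Qed.

End Packings.

(** * Packings against [rainbow_phi], greedy rainbow cliques, and cliques through one vertex *)

Section PackingTools.
Variables (T : finType) (C : eqType) (chi : {set T} -> C).
Implicit Types (E F : {set {set T}}) (A B K W : {set T}) (u v x y : T).

Lemma card_bigcup_leq (I : finType) (P : pred I) (F : I -> {set T}) :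
  #|\bigcup_(i | P i) F i| <= \sum_(i | P i) #|F i|.
Proof.
elim/big_rec2: _ => [|i n A _ IH]; first by rewrite cards0.
exact: leq_trans (leq_card_setU _ _) (leq_add _ _).
Qed.

Lemma is_copy_pairs r K : #|K| = r -> is_copy (complete_graph r) (pairs K).
Proof.
move=> cK; pose f := [ffun i : 'I_r => enum_val (cast_ord (esym cK) i)].
have f_inj : injective f.
  by move=> i j; rewrite !ffunE => /enum_val_inj /cast_ord_inj.
have fK i : f i \in K by rewrite ffunE enum_valP.
have Kf x : x \in K -> exists i, x = f i.
  move=> Kx; exists (cast_ord cK (enum_rank_in Kx x)).
  by rewrite ffunE cast_ordK enum_rankK_in.
apply/existsP; exists f; apply/andP; split; first exact/injectiveP.
apply/eqP/setP => e; apply/idP/imsetP => [|[A]].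
  rewrite inE => /andP[sK e2]; exists (f @^-1: e).
    rewrite inE -(eqP e2) -(card_imset _ f_inj); apply/eqP/eq_card => y.
    apply/imsetP/idP => [[i]|ey]; first by rewrite inE => ei ->.
    by have [i defy] := Kf _ (subsetP sK _ ey); exists i; rewrite // inE -defy.
  apply/setP => y; apply/idP/imsetP => [ey|[i]]; last by rewrite inE => ei ->.
  by have [i defy] := Kf _ (subsetP sK _ ey); exists i; rewrite // inE -defy.
rewrite inE => A2 ->; rewrite inE card_imset // A2 andbT.
by apply/subsetP => y /imsetP[i _ ->].
Qed.

(** Each clique can serve as one part in place of ['C(r, 2)] single edges. The induction peels off
    one clique [K] and adds [pairs K] to an optimal decomposition of the remaining edges. *)
Lemma phi_packing r E Q : 1 < r -> packing chi r E Q ->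
  rainbow_phi E chi (complete_graph r) + ('C(r, 2) - 1) * #|Q| <= #|E|.
Proof.
move=> r_gt1; move: {2}#|Q| (erefl #|Q|) => k.
elim: k E Q => [|k IH] E Q cQ PQ.
  rewrite cQ muln0 addn0.
  apply: leq_trans (rainbow_phi_le (singletons_decomposition E chi _)) _.
  exact: leq_imset_card.
have [QE Qd] := PQ.
have [K QK] : exists K, K \in Q by apply/set0Pn; rewrite -cards_eq0 cQ.
have [cK /andP[sKE rK]] := QE K QK.
have PQ' : packing chi r (E :\: pairs K) (Q :\ K).
  split=> [K' /setD1P[neqK QK']|K1 K2 /setD1P[_ K1Q] /setD1P[_]]; last exact: Qd.
  have [-> /andP[sK' rK']] := QE K' QK'; split=> //.
  by rewrite /rainbow_clique rK' andbT subsetD sK' Qd.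
have cQ' : #|Q :\ K| = k by move: (cardsD1 K Q); rewrite QK cQ => -[].
have {}IH := IH _ _ cQ' PQ'; rewrite cQ' in IH.
have cpK : #|pairs K| = 'C(r, 2) by rewrite card_pairs cK.
have pK0 : 0 < 'C(r, 2) by rewrite bin_gt0.
have cE := cardsID (pairs K) E; rewrite (setIidPr sKE) cpK in cE.
have [P /andP[partP decP] cP] :=
  rainbow_phi_attained (E :\: pairs K) chi (complete_graph r).
suff : rainbow_phi E chi (complete_graph r) <= #|P|.+1.
  by rewrite cQ mulnS; lia.
have defE : pairs K :|: (E :\: pairs K) = E.
  by rewrite -[RHS](setID _ (pairs K)) (setIidPr sKE).
apply: leq_trans (rainbow_phi_le (P := pairs K |: P) _) _; last first.
  by rewrite cardsU1; case: (_ \notin _); rewrite ?ltnS //= leqnSn.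
rewrite /rainbow_decomposition -{1}defE partitionU1 //=; first last.
- by rewrite -setI_eq0 setDE setICA setICr setI0.
- by rewrite -cards_eq0 cpK -lt0n.
apply/forall_inP => D /setU1P[->|PD]; last exact: (forall_inP decP).
by rewrite is_copy_pairs // rK orbT.
Qed.

(** The packing is enlarged while the uncovered edges still contain a rainbow clique. Since its size
    never drops, density bounds known for [Q] carry over to [Q']. *)
Lemma maximal_packing r E Q : 1 < r -> packing chi r E Q ->
  exists Q', [/\ packing chi r E Q', #|Q| <= #|Q'| &
    forall K : {set T}, #|K| = r ->
      ~~ rainbow_clique chi (E :\: \bigcup_(K' in Q') pairs K') K].
Proof.
move=> r_gt1; pose rest (Q : {set {set T}}) := E :\: \bigcup_(K' in Q) pairs K'.
have [n] := ubnP #|rest Q|; elim: n Q => // n IH Q /ltnSE ltQ PQ.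
have [/existsP[K /andP[/eqP cK rK]]|noK] :=
    boolP [exists K : {set T}, (#|K| == r) && rainbow_clique chi (rest Q) K]; last first.
  exists Q; split=> // K cK; apply: contra noK => rK.
  by apply/existsP; exists K; rewrite cK eqxx.
have [QE Qd] := PQ; have [sK rbK] := andP rK.
have K0 : 0 < #|pairs K| by rewrite card_pairs cK bin_gt0.
have sKE : pairs K \subset E by apply: subset_trans sK _; apply: subsetDl.
have dK K' : K' \in Q -> [disjoint pairs K & pairs K'].
  move=> QK'; rewrite disjoint_subset; apply/subsetP => e /(subsetP sK).
  by rewrite !inE => /andP[+ _]; apply: contra => eK'; apply/bigcupP; exists K'; rewrite // inE.
have [||Q' [PQ' leQ' maxQ']] := IH (K |: Q).
- apply: leq_trans ltQ; apply: proper_card; apply/properP; split.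
    apply: setDS; apply/bigcupsP => K' QK'.
    by apply: bigcup_sup; rewrite setU1r.
  have [e eK] := card_gt0P K0; exists e; first exact: (subsetP sK).
  rewrite !inE negb_and negbK; apply/orP; left.
  by apply/bigcupP; exists K; rewrite ?setU11.
- split=> [K' /setU1P[->|/QE//]|K1 K2].
    by rewrite cK; split=> //; rewrite /rainbow_clique sKE.
  case/setU1P => [->|QK1] /setU1P[->|QK2]; rewrite ?eqxx // => neqK; first exact: dK.
    by rewrite disjoint_sym dK.
  exact: Qd.
exists Q'; split=> //; apply: leq_trans leQ'; apply: subset_leq_card.
exact: subsetUr.
Qed.

(* The forbidden vertices are those joined to some y in K by an edge that
   repeats a color of K; properness leaves one of them for each triple. *)
Lemma rainbow_extension E W K :
  E \subset pairs W -> proper_edge_coloring E chi -> rainbow_clique chi E K ->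
  exists F : {set T}, #|F| <= #|K| ^ 3 /\
    forall v, v \notin F -> K \subset nb E v -> rainbow_clique chi E (v |: K).
Proof.
move=> sEW prop /andP[sK rK].
pose G (p : T * (T * T)) : {set T} :=
  [set v | ([set v; p.1] \in E) && (chi [set v; p.1] == chi [set p.2.1; p.2.2])].
have share v v' y : v' != v -> [set v; y] \in E -> [set v'; y] \in E ->
    chi [set v; y] != chi [set v'; y].
  move=> neqv Ev Ev'; apply: prop => //; last first.
    by apply/set0Pn; exists y; rewrite !inE !eqxx !orbT.
  apply: contra neqv => /eqP eqv; have : v' \in [set v; y] by rewrite eqv set21.
  rewrite !inE => /orP[//|/eqP eqy]; move: (subsetP sEW _ Ev').
  by rewrite eqy mem_pairs2 eqxx !andbF.
exists (\bigcup_(p in setX K (setX K K)) G p); split.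
  apply: leq_trans (card_bigcup_leq _ _) _.
  have -> : #|K| ^ 3 = \sum_(p in setX K (setX K K)) 1.
    by rewrite sum1_card !cardsX !expnS expn0 muln1.
  apply: leq_sum => -[y [a b]] _; apply/card_le1_eqP => v v' /=.
  rewrite !inE /= => /andP[Ev /eqP cv] /andP[Ev' /eqP cv'].
  apply/eqP; rewrite eq_sym; apply: contraT => neqv.
  by have := share v' v y neqv Ev' Ev; rewrite cv cv' eqxx.
move=> v vF sKv.
have Ev y : y \in K -> [set v; y] \in E by move/(subsetP sKv); rewrite inE.
have mixed y e : y \in K -> e \in pairs K -> chi [set v; y] != chi e.
  move=> Ky /pairsP[a [b [Ka Kb _ ->]]]; apply: contra vF => cv.
  by apply/bigcupP; exists (y, (a, b)); rewrite !inE ?Ky ?Ka ?Kb // Ev.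
have split_e e : e \in pairs (v |: K) ->
    e \in pairs K \/ exists2 y, y \in K & e = [set v; y].
  move=> /[dup] + /pairsP[x [y [Kx Ky neqxy ->]]]; move: Kx Ky neqxy.
  case/setU1P => [->|Kx] /setU1P[->|Ky]; rewrite ?eqxx // => neqxy _.
  - by right; exists y.
  - by right; exists x; rewrite // setUC.
  - by left; rewrite mem_pairs2 Kx Ky.
apply/andP; split.
  apply/subsetP => e /split_e[/(subsetP sK)//|[y Ky ->]]; exact: Ev.
apply/dinjectiveP => e e' /split_e[Ke|[y Ky ->]] /split_e[Ke'|[y' Ky' ->]] eqc.
- exact: (dinjectiveP _ _ rK).
- by have := mixed y' e Ky' Ke; rewrite eqc eqxx.
- by have := mixed y e' Ky Ke'; rewrite eqc eqxx.
case: (eqVneq y' y) => [-> //|neqy].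
have := share y y' v neqy; rewrite ![[set _; v]]setUC eqc eqxx.
by move=> /(_ (Ev _ Ky) (Ev _ Ky')).
Qed.

Lemma rainbow_clique1 E x : rainbow_clique chi E [set x].
Proof.
rewrite /rainbow_clique; have -> : pairs [set x] = set0.
  by apply/eqP; rewrite -cards_eq0 card_pairs cards1.
by rewrite sub0set; apply/dinjectiveP => e e'; rewrite inE.
Qed.

(** Vertices are picked one at a time outside the at most [(#|X| + p) ^ 3] forbidden ones, and each
    pick costs at most [h] candidates. The last pick needs no further candidates, so [h] is paid
    only [p - 1] times; hence the [h] on the right. *)
Lemma greedy_clique E W h : E \subset pairs W -> proper_edge_coloring E chi ->
    {in W, forall v, #|W :\: nb E v| <= h} ->
  forall p X A, rainbow_clique chi E X -> A \subset W ->
    {in A, forall v, X \subset nb E v} -> (#|X| + p) ^ 3 + p * h < #|A| + h ->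
  exists K, [/\ K \subset A, #|K| = p & rainbow_clique chi E (X :|: K)].
Proof.
move=> sEW prop degW; elim=> [|p IH] X A rX sAW AX bound.
  by exists set0; rewrite sub0set cards0 setU0.
have [F [cF Fext]] := rainbow_extension sEW prop rX.
have [v /setDP[Av vF]] : exists v, v \in A :\: F.
  apply/card_gt0P; 
  have le3 : #|X| ^ 3 <= (#|X| + p.+1) ^ 3 by rewrite leq_exp2r // leq_addr.
  have := cardsID F A; have := subset_leq_card (subsetIr A F).
  by rewrite mulSn in bound; lia.
have rvX := Fext v vF (AX v Av).
have vX : v \notin X.
  by apply: contra (nb_irr v sEW) => /(subsetP (AX v Av)).
have [|||K [sK cK rK]] := IH (v |: X) (A :&: nb E v) rvX.
- exact: subset_trans (subsetIl _ _) sAW.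
- move=> u /setIP[Au nbu]; rewrite subUset sub1set AX // andbT.
  by rewrite nb_sym.
- rewrite cardsU1 vX add1n addSnnS.
  have := cardsID (nb E v) A; have := degW v (subsetP sAW v Av).
  have := subset_leq_card (setSD (nb E v) sAW).
  by rewrite mulSn in bound; lia.
have vK : v \notin K.
  by apply/negP => /(subsetP sK)/setIP[_]; rewrite (negPf (nb_irr v sEW)).
exists (v |: K); split; last 1 first.
- by rewrite setUCA setUA.
- by rewrite subUset sub1set Av (subset_trans sK (subsetIl _ _)).
- by rewrite cardsU1 vK cK.
Qed.

Definition star_rest E x (M : {set {set T}}) :=
  [set e in E | (x \notin e) && [forall K in M, ~~ (e \subset K)]].

Lemma star_rest_sub E x M : star_rest E x M \subset E.
Proof. by apply/subsetP => e; rewrite inE => /andP[]. Qed.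

(** [M] holds the traces on the neighborhood of [x]; the cliques themselves are the sets
    [x |: K]. *)
Definition star_family q E x (M : {set {set T}}) : Prop :=
  {in M, forall K, [/\ #|K| = q, x \notin K & rainbow_clique chi E (x |: K)]} /\
  {in M &, forall K K', K != K' -> [disjoint K & K']}.

(** Two cliques [x |: K] with disjoint traces share only the vertex [x], hence no edge. Their edges
    pass through [x] or lie inside a trace, so none survives in [star_rest]. *)
Lemma star_packing q E x (M Q : {set {set T}}) : 0 < q -> star_family q E x M ->
    packing chi q.+1 (star_rest E x M) Q ->
  exists Q', packing chi q.+1 E Q' /\ #|Q'| = #|Q| + #|M|.
Proof.
move=> q_gt0 [ME Md] PQ; pose S := [set x |: K | K in M].
have cS : #|S| = #|M|.
  rewrite card_in_imset // => K K' /ME[_ xK _] /ME[_ xK' _] eqK.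
  by rewrite -(setU1K xK) -(setU1K xK') eqK.
have PS : packing chi q.+1 (E :\: star_rest E x M) S.
  split=> [_ /imsetP[K MK ->]|_ _ /imsetP[K MK ->] /imsetP[K' MK' ->] neqS].
    have [cK xK /andP[sK rK]] := ME K MK; rewrite cardsU1 xK cK; split=> //.
    rewrite /rainbow_clique rK andbT subsetD sK disjoint_subset.
    apply/subsetP => e eK; rewrite !inE (subsetP sK) //= negb_and negbK.
    have [//|xe] := boolP (x \in e); apply/forall_inPn; exists K; rewrite // negbK.
    move: eK; rewrite inE => /andP[/subsetP se _].
    apply/subsetP => y ey; have /setU1P[eqy|//] := se y ey.
    by rewrite -eqy ey in xe.
  have neqK : K != K' by apply: contra neqS => /eqP->.
  have dK := Md K K' MK MK' neqK; rewrite disjoint_subset; apply/subsetP => e.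
  move=> /pairsP[a [b [Ka Kb neqab ->]]]; rewrite inE mem_pairs2 neqab andbT.
  have both y : y \in x |: K -> y \in x |: K' -> y = x.
    case/setU1P => // Ky /setU1P[]// Ky'.
    by have := disjointFr dK Ky; rewrite Ky'.
  apply/negP => /andP[/(both a Ka) eqa /(both b Kb) eqb].
  by rewrite eqa eqb eqxx in neqab.
have dE : [disjoint star_rest E x M & E :\: star_rest E x M].
  by rewrite disjoint_sym -setI_eq0 setIDAC setDIl setDv setI0.
have q1 : 1 < q.+1 by [].
have [PU cU] := packingU q1 (star_rest_sub E x M) (subsetDl _ _) dE PQ PS.
by exists (Q :|: S); rewrite cU cS.
Qed.

(** The edges at [x] are counted once for all cliques, so each clique costs only the ['C(q, 2)]
    edges of its trace; this is the source of the gain. *)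
Lemma card_star_rest q E W x (M : {set {set T}}) : E \subset pairs W ->
    {in M, forall K : {set T}, #|K| = q} ->
  #|E| <= #|star_rest E x M| + #|nb E x| + #|M| * 'C(q, 2).
Proof.
move=> sEW Mq.
have cI := card_incident sEW (in_setT x); rewrite setIT in cI.
apply: leq_trans (leq_add (leqnn _) (card_cover_pairs Mq)).
rewrite -cI; apply: leq_trans (leq_add (leq_card_setU _ _) (leqnn _)).
apply: leq_trans (leq_card_setU _ _).
apply: subset_leq_card; apply/subsetP => e Ee; rewrite !inE Ee subsetT /=.
have [//|xe] := boolP (x \in e); rewrite orbF /=.
have [//|] := boolP [forall K in M, ~~ (e \subset K)].
case/forall_inPn => K MK; rewrite negbK => sK; apply/bigcupP; exists K => //.
by move: (subsetP sEW e Ee); rewrite !inE sK => /andP[].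
Qed.

End PackingTools.

(** * Degree counting and matchings from minimum degree *)

Section DegreeSums.
Variable T : finType.
Implicit Types (E F : {set {set T}}) (A B K W : {set T}) (u v x y : T).

Definition monochromatic (f : T -> nat) (e : {set T}) : bool :=
  [forall x in e, forall y in e, f x == f y].

Lemma monochromatic2 f x y : monochromatic f [set x; y] = (f x == f y).
Proof.
apply/forall_inP/eqP => [/(_ x (set21 x y))/forall_inP/(_ y (set22 x y))/eqP//|eqf].
move=> a /set2P[]-> ; apply/forall_inP => b /set2P[]->; by rewrite ?eqf.
Qed.

Lemma card_edges_in E A B : B \subset A ->
  #|E :&: pairs B| = \sum_(e in E :&: pairs A) (e \subset B).
Proof.
move=> sBA; rewrite -sum1_card big_mkcond [RHS]big_mkcond; apply: eq_bigr => e _.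
rewrite !inE; case: (e \in E) => //=; case: (#|e| == 2); rewrite ?andbF // !andbT.
case: ifP => [sB|]; first by rewrite (subset_trans sB sBA).
by case: ifP.
Qed.

(** The identity holds edge by edge: an edge inside [A] with 0, 1 or 2 endpoints in [B] contributes
    1, 1 or 2 to each side. *)
Lemma card_edges_split E W A B : E \subset pairs W -> B \subset A ->
  #|E :&: pairs A| + #|E :&: pairs B| =
  #|E :&: pairs (A :\: B)| + \sum_(v in B) #|nb E v :&: A|.
Proof.
move=> sEW sBA.
have -> : \sum_(v in B) #|nb E v :&: A| =
          \sum_(e in E :&: pairs A) \sum_(v in B) (v \in e).
  rewrite exchange_big /=; apply: eq_bigr => v Bv.
  rewrite -(card_incident sEW (subsetP sBA v Bv)) -sum1_card big_mkcond.
  rewrite [RHS]big_mkcond; apply: eq_bigr => e _; rewrite !inE.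
  have [Ee|//] := boolP (e \in E); move: (subsetP sEW e Ee).
  rewrite inE => /andP[_ ->]; rewrite /= andbT; case: (e \subset A) => //=.
rewrite (card_edges_in E (subxx A)) (card_edges_in E sBA).
rewrite (card_edges_in E (subsetDl A B)) -!big_split /=.
apply: eq_bigr => e /setIP[_ /pairsP[x [y [Ax Ay neqxy ->]]]].
rewrite !subUset !sub1set !inE Ax Ay !andbT.
have -> : \sum_(v in B) (v \in [set x; y]) = (x \in B) + (y \in B).
  have -> : \sum_(v in B) (v \in [set x; y]) = \sum_(v in [set x; y]) (v \in B).
    rewrite big_mkcond [RHS]big_mkcond; apply: eq_bigr => v _.
    by case: (v \in B); case: (v \in [set x; y]).
  by rewrite big_setU1 ?inE //= big_set1.
by case: (x \in B); case: (y \in B).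
Qed.

Lemma handshake E W : E \subset pairs W -> 2 * #|E| = \sum_(v in W) #|nb E v|.
Proof.
move=> sEW; have := card_edges_split sEW (subxx W).
rewrite setDv (setIidPl sEW) addnn -mul2n => ->.
have -> : E :&: pairs set0 = set0.
  apply/eqP; rewrite -cards_eq0 -leqn0.
  by rewrite (leq_trans (subset_leq_card (subsetIr _ _))) // card_pairs cards0.
by rewrite cards0; apply: eq_bigr => v _; rewrite (setIidPl (nb_sub v sEW)).
Qed.

(* Augmentation: if u and w are unmatched with all their neighbors matched,
   then some matched edge receives at least three edges from {u, w}. *)
Lemma matching_min_degree E W A D s : E \subset pairs W ->
    {in A, forall v, D <= #|nb E v :&: A|} -> s <= D -> 2 * s <= #|A| ->
  exists M : {set {set T}}, [/\ M \subset E :&: pairs A, #|M| = s &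
    {in M &, forall e e' : {set T}, e != e' -> [disjoint e & e']}].
Proof.
move=> sEW degA; elim: s => [|s IH] leD leA.
  exists set0; rewrite sub0set cards0; split=> // e e'; by rewrite inE.
have [||M [sM cM dM]] := IH; [lia|lia|].
have MP e : e \in M -> [/\ e \in E, e \subset A & #|e| = 2].
  by move/(subsetP sM); rewrite !inE => /and3P[-> -> /eqP].
pose U := \bigcup_(e in M) e.
have cU : #|U| <= 2 * s.
  apply: leq_trans (card_bigcup_leq _ _) _.
  rewrite (eq_bigr (fun=> 2)) => [|e /MP[]//]; by rewrite sum_nat_const cM mulnC.
have grow u y : u \in A -> u \notin U -> y \in nb E u -> y \in A -> y \notin U ->
    exists M' : {set {set T}}, [/\ M' \subset E :&: pairs A, #|M'| = s.+1 &
      {in M' &, forall e e' : {set T}, e != e' -> [disjoint e & e']}].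
  move=> Au Uu nby Ay Uy; exists ([set u; y] |: M).
  have dN e : e \in M -> [disjoint [set u; y] & e].
    move=> Me; rewrite -setI_eq0; apply/eqP/setP => z; rewrite !inE.
    by apply/negP => /andP[/orP[]/eqP-> ez];
      [case/negP: Uu|case/negP: Uy]; apply/bigcupP; exists e.
  have NM : [set u; y] \notin M.
    by apply: contra Uu => Me; apply/bigcupP; exists [set u; y]; rewrite ?set21.
  have Euy : [set u; y] \in E by move: nby; rewrite inE.
  split; last first.
  - move=> e e' /setU1P[->|Me] /setU1P[->|Me']; rewrite ?eqxx // => neqe.
    + exact: dN.
    + by rewrite disjoint_sym dN.
    + exact: dM.
  - by rewrite cardsU1 NM cM.
  rewrite subUset sM andbT sub1set inE Euy mem_pairs2 Au Ay.
  by move: (subsetP sEW _ Euy); rewrite mem_pairs2 => /and3P[_ _ ->].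
have /card_gt1P[u [w [/setDP[Au Uu] /setDP[Aw Uw] neq_uw]]] : 1 < #|A :\: U|.
  by have := cardsID U A; have := subset_leq_card (subsetIr A U); lia.
have [/subsetPn[y /setIP[nby Ay] Uy]|sU] := boolP (~~ (nb E u :&: A \subset U)).
  exact: grow nby Ay Uy.
have [/subsetPn[y /setIP[nby Ay] Uy]|sU'] := boolP (~~ (nb E w :&: A \subset U)).
  exact: grow nby Ay Uy.
rewrite !negbK in sU sU'.
have dsum z : nb E z :&: A \subset U -> D <= #|nb E z :&: A| ->
    D <= \sum_(e in M) #|nb E z :&: e|.
  move=> sz /leq_trans; apply.
  rewrite -(setIidPl sz) /U -setIA.
  apply: leq_trans (subset_leq_card _) (card_bigcup_leq _ _).
  apply/subsetP => t /setIP[nbt /setIP[_ /bigcupP[e Me et]]].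
  by apply/bigcupP; exists e; rewrite // inE nbt.
(* Over [M] each of the two sums is at least [D > s], so their total exceeds [2 * s]. *)
have [e Me gt2] : exists2 e, e \in M & 2 < #|nb E u :&: e| + #|nb E w :&: e|.
  apply/exists_inP; apply: contraT; rewrite negb_exists_in => /forall_inP le2.
  have : \sum_(e in M) (#|nb E u :&: e| + #|nb E w :&: e|) <= s * 2.
    by rewrite -cM -sum_nat_const; apply: leq_sum => e /le2; rewrite -leqNgt.
  rewrite big_split /=; have := dsum u sU (degA u Au).
  by have := dsum w sU' (degA w Aw); move: leD => /=; clear; lia.
have [Ee sA e2] := MP e Me.
have Ue z : z \in e -> z \in U by move=> ez; apply/bigcupP; exists e.
have [a [b [ea eb neq_ab [nba nbb]]]] : exists a b,
    [/\ a \in e, b \in e, a != b & a \in nb E u /\ b \in nb E w].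
  have /cards2P[a [b [neq_ab defe]]] : #|e| == 2 by rewrite e2.
  have cI z : #|nb E z :&: e| = (a \in nb E z) + (b \in nb E z).
    rewrite -sum1_card big_mkcond /= (bigD1 a) //= (bigD1 b) 1?eq_sym //=.
    rewrite !(in_setI, defe, in_set2) !eqxx ?orbT !andbT big1 ?addn0 => [|i].
      by case: (a \in nb E z); case: (b \in nb E z).
    by case/andP=> /negPf ia /negPf ib; rewrite in_setI in_set2 ia ib andbF.
  move: gt2; rewrite !cI.
  case au: (a \in nb E u); case bw: (b \in nb E w);
    case bu: (b \in nb E u); case aw: (a \in nb E w) => // _;
    by [exists a, b; rewrite defe set21 set22
      | exists b, a; rewrite defe set21 set22 eq_sym].
have defe : e = [set a; b].
  apply/esym/eqP; rewrite eqEcard e2 cards2 neq_ab andbT.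
  by rewrite subUset !sub1set ea eb.
pose N := M :\ e.
have NU z t : t \in N -> z \in t -> z != a /\ z != b.
  case/setD1P => neqt Mt zt; have := disjointFr (dM t e Mt Me neqt) zt.
  by rewrite defe !inE => /norP.
have NUu z t : z \notin U -> t \in N -> z \notin t.
  move=> Uz /setD1P[_ Mt]; apply: contra Uz => zt; by apply/bigcupP; exists t.
have Eua : [set u; a] \in E by move: nba; rewrite inE.
have Ewb : [set w; b] \in E by move: nbb; rewrite inE.
have [Ua Ub] := (Ue a ea, Ue b eb).
have neq_U z t : z \notin U -> t \in U -> z != t.
  by move=> Uz; apply: contraTneq => <-.
have d12 : [disjoint [set u; a] & [set w; b]].
  rewrite -setI_eq0; apply/eqP/setP => z; rewrite !inE.
  apply/negP => /andP[/orP[]/eqP-> /orP[]/eqP eqz].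
  - by rewrite eqz eqxx in neq_uw.
  - by rewrite eqz Ub in Uu.
  - by rewrite -eqz Ua in Uw.
  - by rewrite eqz eqxx in neq_ab.
have dN z t c : z \notin U -> (c == a) || (c == b) -> t \in N ->
    [disjoint [set z; c] & t].
  move=> Uz cab Nt; rewrite -setI_eq0; apply/eqP/setP => y; rewrite !inE.
  apply/negP => /andP[/orP[]/eqP-> yt].
    by rewrite (negPf (NUu z t Uz Nt)) in yt.
  by have [na nb'] := NU c t Nt yt; rewrite (negPf na) (negPf nb') in cab.
have dua t : t \in N -> [disjoint [set u; a] & t] by apply: dN; rewrite ?eqxx.
have dwb t : t \in N -> [disjoint [set w; b] & t].
  by apply: dN; rewrite ?eqxx ?orbT.
have notN z c : z \notin U -> [set z; c] \notin N.
  by move=> Uz; apply/negP => /(NUu z _ Uz); rewrite set21.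
(* The edge [e] is traded for the two disjoint edges [[set u; a]] and [[set w; b]]. *)
exists ([set u; a] |: ([set w; b] |: N)); split; last first.
- move=> t t' /setU1P[->|/setU1P[->|Nt]] /setU1P[->|/setU1P[->|Nt']];
    rewrite ?eqxx // => neqt.
  + exact: dua.
  + by rewrite disjoint_sym.
  + exact: dwb.
  + by rewrite disjoint_sym dua.
  + by rewrite disjoint_sym dwb.
  + by case/setD1P: Nt => _ Mt; case/setD1P: Nt' => _ Mt'; apply: dM.
- rewrite !cardsU1 notN // !inE negb_or -!in_setD1 -/N notN // andbT.
  have -> : [set u; a] != [set w; b].
    by apply: contraTneq d12 => ->; rewrite -setI_eq0 setIid; apply/set0Pn; exists w; rewrite set21.
  by have := cardsD1 e M; rewrite Me cM -/N => -[->].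
rewrite !subUset !sub1set (subset_trans _ sM) ?subsetDl // andbT.
rewrite !in_setI Eua Ewb !mem_pairs2 Au Aw (subsetP sA a ea) (subsetP sA b eb).
by rewrite !neq_U.
Qed.

End DegreeSums.

(** The witness is the complete [q]-partite graph on the residue classes modulo [q]. A class has at
    most [n %/ q + 1] vertices, which bounds all degrees from below, and by pigeonhole [q.+1]
    vertices cannot have distinct residues. *)
Lemma turan_lower q n : 0 < q ->
  q.-1 * n ^ 2 <= 2 * q * turan_number n (complete_graph q.+1) + q * n.
Proof.
move=> q_gt0; pose f (i : 'I_n) := i %% q.
pose E : {set {set 'I_n}} := [set e in pairs [set: 'I_n] | ~~ monochromatic f e].
have sE : E \subset pairs [set: 'I_n].
  by apply/subsetP => e; rewrite inE => /andP[].
have class v : #|[set y | f y == f v]| <= (n %/ q).+1.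
  rewrite -(card_ord (n %/ q).+1).
  rewrite -(@card_in_imset _ _ (fun i : 'I_n => inord (i %/ q) : 'I_(n %/ q).+1)).
    exact: max_card.
  move=> i j; rewrite !inE => /eqP fi /eqP fj /(congr1 val) /=.
  rewrite !inordK ?ltnS ?leq_div2r ?(ltnW (ltn_ord _)) // => eqd.
  by apply/val_inj; rewrite /= (divn_eq i q) (divn_eq j q) eqd -/(f i) -/(f j) fi fj.
have deg v : n <= #|nb E v| + (n %/ q).+1.
  apply: leq_trans (leq_add (leqnn _) (class v)).
  rewrite -{1}(card_ord n) -cardsT; apply: leq_trans (leq_card_setU _ _).
  apply: subset_leq_card; apply/subsetP => y _; rewrite !inE monochromatic2.
  rewrite subUset !sub1set !inE cards2 [f v == _]eq_sym.
  have [_|neqf] := eqVneq (f y) (f v); first by rewrite orbT.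
  by have [eqv|//] := eqVneq v y; rewrite eqv eqxx in neqf.
have cE : n * n <= 2 * #|E| + n * (n %/ q).+1.
  rewrite (handshake sE).
  have s1 k : \sum_(v in [set: 'I_n]) k = n * k.
    by rewrite sum_nat_const cardsT card_ord.
  by rewrite -(s1 n) -(s1 (n %/ q).+1) -big_split; apply: leq_sum => v _; apply: deg.
have Efree : is_free (complete_graph q.+1) E.
  apply/existsP => -[D /andP[sDE /existsP[g /andP[/injectiveP g_inj /eqP defD]]]].
  pose h (i : 'I_q.+1) := Ordinal (ltn_pmod (g i) q_gt0).
  have h_inj : injective h.
    move=> i j /(congr1 val) /= eqh; apply: contraTeq isT => neqij.
    have : [set g i; g j] \in E.
      apply: (subsetP sDE); rewrite defD; apply/imsetP; exists [set i; j].
        by rewrite inE cards2 neqij.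
      by rewrite imsetU1 imset_set1.
    by rewrite inE monochromatic2 => /andP[_]; rewrite /f eqh eqxx.
  by have := leq_card h h_inj; rewrite !card_ord ltnn.
have leT : #|E| <= turan_number n (complete_graph q.+1).
  rewrite /turan_number; apply: (bigop.bigmax_sup E) => //; rewrite Efree andbT.
  by apply/forall_inP => e /(subsetP sE); rewrite inE => /andP[].
have := leq_trunc_div n q; nia.
Qed.

(** * Stability for graphs without rainbow cliques *)

Section Stability.
Variables (T : finType) (C : eqType) (chi : {set T} -> C).
Implicit Types (E F : {set {set T}}) (A B K W : {set T}) (u v x y : T).

Definition mono_in E A (f : T -> nat) : {set {set T}} :=
  [set e in E :&: pairs A | monochromatic f e].

Lemma card_mono_in_leq E A f : #|mono_in E A f| <= #|E :&: pairs A|.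
Proof. by apply: subset_leq_card; apply/subsetP => e; rewrite inE => /andP[]. Qed.

Lemma card_pairs_leq E A : 2 * #|E :&: pairs A| <= #|A| * #|A|.
Proof.
have := subset_leq_card (subsetIr E (pairs A)); rewrite card_pairs bin2.
have := leq_trunc_div (#|A| * #|A|.-1) 2; rewrite divn2.
by have := leq_mul (leqnn #|A|) (leq_pred #|A|); lia.
Qed.

(** The class [p] given to [B] is new because [f] stays below [p], so no edge between [B] and
    [A :\: B] is monochromatic. *)
Lemma card_mono_in_split E A B f f' p :
    B \subset A -> {in A :\: B, f' =1 f} -> {in B, forall v, f' v = p} ->
    (forall v, f v < p) ->
  #|mono_in E A f'| <= #|mono_in E (A :\: B) f| + #|E :&: pairs B|.
Proof.
move=> sBA eqf fB ltp; apply: leq_trans (leq_card_setU _ _).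
apply: subset_leq_card; apply/subsetP => e; rewrite !inE -!andbA.
case/and4P => Ee sA e2 mono.
have /pairsP[x [y [Ax Ay _ defe]]] : e \in pairs A by rewrite inE sA e2.
rewrite Ee e2 /= {e Ee sA e2}defe monochromatic2 in mono *.
rewrite monochromatic2 !subUset !sub1set !in_setD Ax Ay !andbT.
have [Bx|Bx] := boolP (x \in B); have [By|By] := boolP (y \in B); rewrite //= ?orbF.
- by move: mono; rewrite (fB x) // eqf ?inE ?By // eq_sym ltn_eqF.
- by move: mono; rewrite (fB y) // eqf ?inE ?Bx // ltn_eqF.
- by rewrite -!eqf ?inE ?Bx ?By.
Qed.

(** After multiplication by [p], the leading terms of the two sides differ by the square of
    [a - p b]. *)
Lemma stability_arith p a b S R :
  0 < p -> 2 * p * S <= p.-1 * a ^ 2 + 4 * p ^ 2 * R ->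
  2 * p.+1 * (S + a * b + R) <= p * (a + b) ^ 2 + 4 * p.+1 ^ 2 * R.
Proof.
case: p => [//|p] _ /= H.
rewrite -(leq_pmul2l (ltn0Sn p)).
have amgm : 2 * (a * (p.+1 * b)) <= a ^ 2 + (p.+1 * b) ^ 2.
  exact: nat_Cauchy.
nia.
Qed.

(* Füredi's argument: if x has the largest degree inside A and B is the set of
   its nonneighbors in A, then summing degrees over B shows that
   e(A) + e(B) is at most e(A \ B) + |A \ B| |B|.  Picking x outside a bounded
   set keeps the chosen vertices a rainbow clique. *)
Lemma rainbow_free_stability_in E W r p X A : 0 < p ->
    E \subset pairs W -> proper_edge_coloring E chi ->
    (forall K : {set T}, #|K| = r -> ~~ rainbow_clique chi E K) ->
    rainbow_clique chi E X -> A \subset W -> {in A, forall v, X \subset nb E v} ->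
    #|X| + p.+1 = r ->
  exists f : T -> nat, (forall v, f v < p) /\
    2 * p * (#|E :&: pairs A| + #|mono_in E A f|)
      <= p.-1 * #|A| ^ 2 + 4 * p ^ 2 * (r ^ 3 * #|W|).
Proof.
move=> p_gt0 sEW prop free; elim: p p_gt0 X A => // p IH _ X A rX sAW AX cX.
have [F [cF Fext]] := rainbow_extension sEW prop rX.
have cAW := subset_leq_card sAW.
have leF : #|F| <= r ^ 3.
  by apply: leq_trans cF _; rewrite leq_exp2r // -cX leq_addr.
(* If [A] lies inside the bounded set [F], its edges are absorbed by the error term. *)
have [sAF|/subsetPn[v0 Av0 Fv0]] := boolP (A \subset F).
  exists (fun=> 0); split=> //; apply: leq_trans (leq_addl _ _).
  have := card_mono_in_leq E A (fun=> 0); have := card_pairs_leq E A.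
  have := leq_trans (subset_leq_card sAF) leF; move: cAW; clear.
  move: #|A| #|W| #|E :&: pairs A| #|mono_in E A _| => a w e m aw ar ea me.
  have := leq_mul ar aw; move: (r ^ 3 * w) => R aaR.
  have eR : e + m <= R by lia.
  apply: (@leq_trans (4 * p.+1 ^ 2 * (e + m))); last by rewrite leq_mul2l eR orbT.
  by rewrite leq_mul2r; nia.
pose deg v := #|nb E v :&: A|.
have P0 : v0 \in A :\: F by rewrite inE Fv0.
case: (arg_maxnP deg P0) => x /setDP[Ax Fx] max_x.
have rX' := Fext x Fx (AX x Ax).
have Xx : x \notin X by apply: contra (nb_irr x sEW); apply/subsetP/AX.
have cX' : #|x |: X| + p.+1 = r by rewrite cardsU1 Xx -cX add1n addSnnS.
pose A' := nb E x :&: A.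
have A'X : {in A', forall v, (x |: X) \subset nb E v}.
  by move=> v /setIP[nbv Av]; rewrite subUset sub1set nb_sym nbv AX.
have sA'A : A' \subset A by apply: subsetIr.
(* Vertices of [F] escape the maximality of [x]. There are at most [r ^ 3] of them, each of degree
   at most [#|W|], whence the error term. *)
have degB B : B \subset A ->
    \sum_(v in B) #|nb E v :&: A| <= #|B| * #|A'| + r ^ 3 * #|W|.
  move=> sB; rewrite (bigID (mem F)) /= addnC leq_add //.
    apply: (@leq_trans (\sum_(v in B) #|A'|)); last by rewrite sum_nat_const.
    rewrite [X in _ <= X](bigID (mem F)) /= addnC.
    apply: leq_trans (leq_addr _ _); apply: leq_sum => v /andP[Bv Fv].
    by apply/max_x/setDP; rewrite (subsetP sB).
  apply: leq_trans (leq_mul leF (leqnn _)); rewrite -sum_nat_const.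
  rewrite [X in _ <= X](bigID (mem B)) /=.
  apply: leq_trans (leq_addr _ _).
  rewrite (eq_bigl (fun v => (v \in F) && (v \in B))) => [|v]; last exact: andbC.
  apply: leq_sum => v _; apply: leq_trans cAW.
  exact: subset_leq_card (subsetIr _ _).
(* With a single class left, a neighbor of [x] in [A] outside a bounded set would complete a rainbow
   clique on [r] vertices. So [A'] is bounded and [A] spans few edges. *)
case: p IH cX cX' => [|p] IH cX cX'.
  have [F' [cF' Fext']] := rainbow_extension sEW prop rX'.
  have sA'F' : A' \subset F'.
    apply/subsetP => v A'v; apply: contraT => F'v.
    have vX' : v \notin x |: X.
      by apply: contra (nb_irr v sEW); apply/subsetP/A'X.
    have := Fext' v F'v (A'X v A'v); apply: contraLR => _; apply: free.
    by rewrite cardsU1 vX' -cX' add1n addn1.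
  have leA' : #|A'| <= r ^ 3.
    apply: leq_trans (subset_leq_card sA'F') (leq_trans cF' _).
    by rewrite leq_exp2r // -cX' leq_addr.
  exists (fun=> 0); split=> //; rewrite mul0n add0n muln1.
  have := card_mono_in_leq E A (fun=> 0); have := degB A (subxx A).
  have := card_edges_split sEW (subxx A); move: cAW leA'; clear.
  rewrite setDv; have -> : #|E :&: pairs set0| = 0.
    apply/eqP; rewrite -leqn0 (leq_trans (subset_leq_card (subsetIr _ _))) //.
    by rewrite card_pairs cards0.
  move: (r ^ 3) (\sum_(v in A) _) #|A| #|W| #|A'| #|E :&: pairs A|
    #|mono_in E A _| => R S a w a' e m.
  nia.
have defB : A :\: (A :\: A') = A' by rewrite setDDr setDv set0U (setIidPr sA'A).
have [f [ltf fP]] := IH isT _ _ rX' (subset_trans sA'A sAW) A'X cX'.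
(* The nonneighbors of [x] form the new class. *)
exists (fun v => if v \in A :\: A' then p.+1 else f v); split=> [v|].
  by case: ifP => // _; apply: ltnW (ltf v).
have := card_mono_in_split E (subsetDl A A')
  (f := f) (f' := fun v => if v \in A :\: A' then p.+1 else f v) (p := p.+1).
rewrite defB => /(_ _ _ ltf) monoS; have {}monoS := monoS _ _.
have splitE := card_edges_split sEW (subsetDl A A'); rewrite defB in splitE.
have degS := degB _ (subsetDl A A').
have cA := cardsID A' A; rewrite (setIidPr sA'A) in cA.
have := stability_arith #|A :\: A'| (ltn0Sn p) fP; rewrite cA.
apply: leq_trans; rewrite leq_mul2l; apply/orP; right.
apply: (@leq_trans (#|E :&: pairs A| + (#|mono_in E A' f| + #|E :&: pairs (A :\: A')|))).
  rewrite leq_add2l; apply: monoS => v; first by move=> A'v /=; rewrite inE A'v.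
  by move=> /= ->.
move: splitE degS; clear; lia.
Qed.

(** Monochromatic edges stand beside [#|E|] on the left, so when [#|E|] is close to the Turán
    density their number is at most the deficit. *)
Lemma rainbow_free_stability E W q : 0 < q ->
    E \subset pairs W -> proper_edge_coloring E chi ->
    (forall K : {set T}, #|K| = q.+1 -> ~~ rainbow_clique chi E K) ->
  exists f : T -> nat, (forall v, f v < q) /\
    2 * q * (#|E| + #|mono_in E W f|)
      <= q.-1 * #|W| ^ 2 + 4 * q ^ 2 * (q.+1 ^ 3 * #|W|).
Proof.
move=> q_gt0 sEW prop free.
have r0 : rainbow_clique chi E set0.
  have p0 : pairs (set0 : {set T}) = set0.
    by apply/eqP; rewrite -cards_eq0 card_pairs cards0.
  rewrite /rainbow_clique p0 sub0set.
  by apply/dinjectiveP => e e'; rewrite inE.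
have [||f [ltf fP]] := rainbow_free_stability_in q_gt0 sEW prop free r0 (subxx W).
- by move=> v _; apply: sub0set.
- by rewrite cards0.
by exists f; rewrite (setIidPl sEW) in fP.
Qed.

End Stability.

(** * Large packings of rainbow cliques in dense graphs *)

Section DensePacking.
Variables (T : finType) (C : eqType) (chi : {set T} -> C).
Implicit Types (E F M : {set {set T}}) (A B K W : {set T}) (u v x y : T).

Lemma proper_edge_coloringS E F : E \subset F ->
  proper_edge_coloring F chi -> proper_edge_coloring E chi.
Proof.
by move=> sEF prop A B EA EB; apply: prop; apply: (subsetP sEF).
Qed.

Lemma star_rest_pairs E W x M :
  E \subset pairs W -> star_rest E x M \subset pairs (W :\ x).
Proof.
move=> sEW; apply/subsetP => e; rewrite inE => /and3P[/(subsetP sEW) + xe _].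
by rewrite !inE subsetD1 xe => /andP[-> ->].
Qed.

Lemma edgeless E W : E \subset pairs W -> #|W| = 0 -> #|E| = 0.
Proof.
move=> sEW W0; apply/eqP; rewrite -leqn0.
by rewrite (leq_trans (subset_leq_card sEW)) // card_pairs W0.
Qed.

Lemma min_degree E W : 0 < #|W| -> E \subset pairs W ->
  exists2 x, x \in W &
    {in W, forall v, #|W :\: nb E v| <= #|W| - #|nb E x|}.
Proof.
case/card_gt0P => x0 Wx0 sEW.
case: (@arg_minnP _ x0 (mem W) (fun v => #|nb E v|) Wx0) => x Wx min_x.
exists x => // v Wv; rewrite cardsD (setIidPr (nb_sub v sEW)).
by apply: leq_sub2l; apply: min_x.
Qed.

Lemma card_nb_leq E W x : E \subset pairs W -> #|nb E x| <= #|W|.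
Proof. by move=> sEW; apply: subset_leq_card (nb_sub x sEW). Qed.

(** Traces are chosen greedily: before the last one, at most [q * (s - 1)] neighbors of [x] are
    used, and [greedy_clique] with [X = [set x]] applies to the others. The guard [0 < s] serves
    callers whose [s] is truncated to 0. *)
Lemma star_family_exists q E W x h s : 0 < q -> E \subset pairs W ->
    proper_edge_coloring E chi -> {in W, forall v, #|W :\: nb E v| <= h} ->
    (0 < s -> q * s + q.+1 ^ 3 + q * h < #|nb E x| + h + q) ->
  exists M, star_family chi q E x M /\ #|M| = s.
Proof.
move=> q_gt0 sEW prop degW bound.
suff [M [_ MP cM]] : exists M, [/\ {in M, forall K, K \subset nb E x},
    star_family chi q E x M & #|M| = s] by exists M.
elim: s bound => [|s IH] bound.
  exists set0; rewrite cards0; split=> //.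
    by move=> K; rewrite inE.
  by split=> [K|K K']; rewrite inE.
have {}bound := bound isT; rewrite mulnS in bound.
have [|M [Mx [MP Md] cM]] := IH; first by move: bound; clear; lia.
pose U := \bigcup_(K in M) K.
have cU : #|U| <= s * q.
  apply: leq_trans (card_bigcup_leq _ _) _.
  by rewrite (eq_bigr (fun=> q)) => [|K /MP[]//]; rewrite sum_nat_const cM.
have [|||K [sK cK]] :=
  greedy_clique sEW prop degW (p := q) (A := nb E x :\: U) (rainbow_clique1 chi E x).
- by apply: subset_trans (subsetDl _ _) (nb_sub x sEW).
- by move=> v /setDP[nbv _]; rewrite sub1set nb_sym.
- have := cardsID U (nb E x); have := subset_leq_card (subsetIr (nb E x) U).
  by rewrite cards1 add1n; move: cU bound; clear; rewrite [s * q]mulnC; lia.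
move=> rK; have sKx := subset_trans sK (subsetDl _ _).
have dU K' : K' \in M -> [disjoint K & K'].
  move=> MK'; rewrite disjoint_subset; apply/subsetP => y /(subsetP sK)/setDP[_].
  by apply: contra => K'y; apply/bigcupP; exists K'.
have MK : K \notin M.
  apply/negP => /dU; rewrite -setI_eq0 setIid -cards_eq0 cK.
  by rewrite eqn0Ngt q_gt0.
exists (K |: M); split.
- by move=> K' /setU1P[->|/Mx].
- split=> [K' /setU1P[->|/MP//]|K1 K2].
    by split=> //; apply/negP => /(subsetP sKx); apply/negP/(nb_irr x sEW).
  case/setU1P => [->|M1] /setU1P[->|M2]; rewrite ?eqxx // => neqK; first exact: dU.
    by rewrite disjoint_sym dU.
  exact: Md.
by rewrite cardsU1 MK cM.
Qed.

Lemma clique_packing_large_arith q C0 m d s e e' k :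
  0 < q -> 0 < m -> d <= m ->
  s = (q * d - q.-1 * m - q.+1 ^ 3) %/ q ->
  e <= e' + d + s * C0 ->
  2 * q * e' <= q.-1 * m.-1 ^ 2 + 2 * q * C0.+1 * k
               + (2 * q.+1 ^ 3 + 3 * q) * m.-1 ->
  2 * q * e <= q.-1 * m ^ 2 + 2 * q * C0.+1 * (k + s)
               + (2 * q.+1 ^ 3 + 3 * q) * m.
Proof.
case: q m => [//|q] [//|m] _ _ _ /=; move: (q.+2 ^ 3) => R defs le_e IH.
have := ltn_ceil (q.+1 * d - q * m.+1 - R) (ltn0Sn q); rewrite -defs => lts.
have step : 2 * q.+1 * d <= q * (2 * m).+1 + 2 * q.+1 * s + 2 * R + 3 * q.+1.
  by nia.
have := leq_mul (leqnn (2 * q.+1)) le_e; rewrite -!mulnn in IH *.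
by move: IH step; clear; lia.
Qed.

(** For the minimum degree [d] and [m = #|W|], [d] is at most [(q - 1) m / q + s + O(1)]. Deleting
    [x] with [s] cliques thus removes, beyond the growth of [(q - 1) m^2 / (2 q)] and up to [O(1)],
    at most ['C(q, 2) + 1] edges per clique. That is below ['C(q.+1, 2) - 1] only when [q > 2]. *)
Lemma clique_packing_large q W E : 1 < q -> E \subset pairs W ->
    proper_edge_coloring E chi ->
  exists Q, packing chi q.+1 E Q /\
    2 * q * #|E| <= q.-1 * #|W| ^ 2 + 2 * q * ('C(q, 2)).+1 * #|Q|
                    + (2 * q.+1 ^ 3 + 3 * q) * #|W|.
Proof.
move=> q_gt1; have [n] := ubnP #|W|; elim: n W E => // n IH W E /ltnSE leW sEW prop.
have [W0|W_gt0] := posnP #|W|.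
  by exists set0; split; [apply: packing0|rewrite (edgeless sEW W0) muln0].
have [x Wx degW] := min_degree W_gt0 sEW.
(* With [h = m - d], this is the largest [s] satisfying [q s + (q + 1)^3 + (q - 1) h <= d], or 0 if
   there is none. *)
pose s := (q * #|nb E x| - q.-1 * #|W| - q.+1 ^ 3) %/ q.
have q_gt0 : 0 < q by apply: ltnW.
have led := card_nb_leq x sEW.
have [|M [MP cM]] := star_family_exists (s := s) (x := x) q_gt0 sEW prop degW.
  move=> s_gt0; have : q * s <= q * #|nb E x| - q.-1 * #|W| - q.+1 ^ 3.
    by rewrite mulnC leq_divM.
  have : 0 < q * s by rewrite muln_gt0 q_gt0.
  move: led q_gt0; move: (q * s) (q.+1 ^ 3) #|nb E x| #|W| => t R d m.
  by clear; case: q => [//|p] /=; rewrite mulnBr; nia.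
have [Wx' cW] : #|W :\ x| < n /\ #|W :\ x| = #|W|.-1.
  by have := cardsD1 x W; rewrite Wx; move: leW W_gt0; clear; lia.
have sE' := star_rest_pairs x M sEW.
have [Q [PQ boundQ]] :=
  IH _ _ Wx' sE' (proper_edge_coloringS (star_rest_sub E x M) prop).
have [Q' [PQ' cQ']] := star_packing q_gt0 MP PQ.
exists Q'; split=> //; rewrite cQ' cM.
rewrite cW in boundQ; apply: (clique_packing_large_arith q_gt0 W_gt0 led (erefl s) _ boundQ).
by rewrite -cM; apply: card_star_rest sEW _ => K /(proj1 MP)[].
Qed.

(** Any two edges of a triangle meet, so properness alone makes it rainbow. *)
Lemma triangle_rainbow E W K : E \subset pairs W -> proper_edge_coloring E chi ->
  #|K| = 3 -> pairs K \subset E -> rainbow_clique chi E K.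
Proof.
move=> sEW prop cK sK; rewrite /rainbow_clique sK.
apply/dinjectiveP => e e' Ke Ke' eqc; apply/eqP; apply: contraT => neqe.
have /negP[] : chi e != chi e'; last by rewrite eqc.
apply: prop; rewrite ?(subsetP sK) //.
move: Ke Ke'; rewrite !inE => /andP[se /eqP ce] /andP[se' /eqP ce'].
have := cardsUI e e'; have : #|e :|: e'| <= 3 by rewrite -cK subset_leq_card // subUset se.
by rewrite ce ce' -card_gt0; move: #|_| #|_| => a b; clear; lia.
Qed.

Lemma matching_star_family E W x M : E \subset pairs W ->
    proper_edge_coloring E chi -> M \subset E :&: pairs (nb E x) ->
    {in M &, forall e e' : {set T}, e != e' -> [disjoint e & e']} ->
  star_family chi 2 E x M.
Proof.
move=> sEW prop sM dM; split=> // K /(subsetP sM)/setIP[EK Kpairs].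
have := Kpairs; rewrite inE => /andP[sK /eqP cK].
have xK : x \notin K.
  by apply/negP => /(subsetP sK); apply/negP/(nb_irr x sEW).
split=> //; apply: triangle_rainbow sEW prop _ _; first by rewrite cardsU1 xK cK.
have /pairsP[a [b [nba nbb neq_ab defK]]] := Kpairs.
have Exa : [set x; a] \in E by move: nba; rewrite inE.
have Exb : [set x; b] \in E by move: nbb; rewrite inE.
rewrite defK in EK *.
apply/subsetP => e /pairsP[y [z [Ky Kz neq_yz ->]]]; move: Ky Kz neq_yz.
rewrite !inE => /or3P[]/eqP-> /or3P[]/eqP->; rewrite ?eqxx // => _ //;
  by rewrite setUC.
Qed.

(* Size of the matching guaranteed in the link of x inside B when #|B| = b, x
   misses at most h vertices of B and each vertex of B misses at most g. *)
Definition link_matching b h g := minn (b - h - g) ((b - h) %/ 2).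

(** The vertices of [A] are used one by one, each with a matching among its neighbors in [B].
    Deleting a matching costs a vertex of [B] at most one neighbor in [B], so [g] grows by one per
    round; the edges from the rest of [A] to [B] survive, so [h] does not change. *)
Lemma crossing_triangles E W A B h g : E \subset pairs W ->
    proper_edge_coloring E chi -> [disjoint A & B] ->
    {in A, forall v, #|B :\: nb E v| <= h} ->
    {in B, forall v, #|B :\: nb E v| <= g} ->
  exists Q, packing chi 3 E Q /\
    #|Q| = \sum_(j < #|A|) link_matching #|B| h (g + j).
Proof.
have [n] := ubnP #|A|; elim: n E A g W => // n IH E A g W /ltnSE leA sEW prop dAB.
move=> degA degB.
have [->|/set0Pn[x Ax]] := eqVneq A set0.
  by exists set0; rewrite !cards0 big_ord0; split=> //; apply: packing0.
have Bx : x \notin B by rewrite (disjointFr dAB Ax).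
pose S := B :&: nb E x; pose s := link_matching #|B| h g.
have cS : #|B| <= #|S| + h.
  by have := cardsID (nb E x) B; have := degA x Ax; rewrite -/S; clear; lia.
have degS : {in S, forall v, #|S| - g <= #|nb E v :&: S|}.
  move=> v /setIP[Bv _]; have := cardsID (nb E v) S; rewrite [S :&: _]setIC.
  have := subset_leq_card (setSD (nb E v) (subsetIl B (nb E x) : S \subset B)).
  by have := degB v Bv; clear; lia.
have [||M [sM cM dM]] := matching_min_degree (s := s) sEW degS.
- by rewrite /s /link_matching; move: cS; clear; lia.
- have := leq_trunc_div (#|B| - h) 2; rewrite /s /link_matching.
  by move: cS; clear; lia.
have MP : star_family chi 2 E x M.
  apply: matching_star_family sEW prop _ dM; apply: subset_trans sM _.
  exact: setIS (pairsS (subsetIr _ _)).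
have MB K : K \in M -> K \subset B /\ #|K| = 2.
  move/(subsetP sM); rewrite !inE => /and3P[_ sK /eqP->]; split=> //.
  exact: subset_trans sK (subsetIl _ _).
have keep v y : v != x -> y \in B -> y \in nb E v ->
    y \in nb (star_rest E x M) v \/ exists2 K, K \in M & [set v; y] \subset K.
  move=> neq_vx By; rewrite !inE => Evy; rewrite Evy /=.
  have [[K MK sK]|] := altP (@exists_inP _ (mem M) (fun K => [set v; y] \subset K)).
    by right; exists K.
  rewrite negb_exists_in => noK; left; rewrite noK andbT negb_or eq_sym neq_vx.
  by apply: contraNneq Bx => ->.
have [||||||Q [PQ cQ]] := IH (star_rest E x M) (A :\ x) g.+1 W.
- by have := cardsD1 x A; rewrite Ax; move: leA; clear; lia.
- exact: subset_trans (star_rest_sub _ _ _) sEW.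
- exact: proper_edge_coloringS (star_rest_sub _ _ _) prop.
- exact: disjointWl (subsetDl _ _) dAB.
- move=> v /setD1P[neq_vx Av]; apply: leq_trans (degA v Av).
  apply: subset_leq_card; apply/subsetP => y /setDP[By nby]; rewrite inE By andbT.
  apply: contra nby => /(keep v y neq_vx By)[//|[K /MB[sK _] sub]].
  have /(subsetP sK) : v \in K by rewrite (subsetP sub) ?set21.
  by rewrite (disjointFr dAB Av).
- move=> v Bv; have neq_vx : v != x by apply: contraNneq Bx => <-.
  have : #|nb M v| <= 1.
    apply/card_le1_eqP => y y'; rewrite !inE => My My'.
    have neq z : [set v; z] \in M -> z != v.
      by move/MB => [_]; rewrite cards2; apply: contra_eqN => /eqP->; rewrite eqxx.
    have eqe : [set v; y] = [set v; y'].
      apply/eqP; apply: contraT => /(dM _ _ My My').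
      by rewrite -setI_eq0 => /eqP/setP/(_ v); rewrite !inE eqxx.
    have : y \in [set v; y'] by rewrite -eqe set22.
    by rewrite !inE (negPf (neq y My)) => /eqP.
  move=> /(leq_add (degB v Bv)); rewrite addn1; apply: leq_trans.
  apply: leq_trans (leq_card_setU _ _).
  apply: subset_leq_card; apply/subsetP => y /setDP[By nby]; rewrite !inE By andbT.
  have [Evy|//] := boolP ([set v; y] \in E); rewrite /=.
  have nbvy : y \in nb E v by rewrite inE.
  have [nby'|[K MK sub]] := keep v y neq_vx By nbvy; first by rewrite nby' in nby.
  suff -> : [set v; y] = K by [].
  have [_ cK] := MB K MK; apply/eqP; rewrite eqEcard sub cK cards2.
  by move: (subsetP sEW _ Evy); rewrite mem_pairs2 => /and3P[_ _ ->].
have [Q' [PQ' cQ']] := star_packing (isT : 0 < 2) MP PQ.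
exists Q'; split=> //; rewrite cQ' cQ cM (cardsD1 x A) Ax addnC big_ord_recl addn0.
by congr (_ + _); apply: eq_bigr => j _; rewrite /= /bump add1n addSnnS.
Qed.

(** The first [3 w] terms are at least [3 w - 2 h] and the last [w] at least [2 w - 2 h], which
    gives [9 w^2 + 2 w^2] and a loss of [8 w h]. *)
Lemma link_matching_sum b h w : 6 * w <= b ->
  11 * w ^ 2 <= \sum_(j < 4 * w) link_matching b h (h + j) + 8 * w * h.
Proof.
move=> leb; have -> : 4 * w = 3 * w + w by lia.
rewrite big_split_ord /=.
have sum_geq n (F : 'I_n -> nat) c :
    (forall j, c <= F j) -> n * c <= \sum_(j < n) F j.
  by move=> leF; rewrite -{1}(card_ord n) -sum_nat_const leq_sum.
have s1 : 3 * w * (3 * w - 2 * h) <=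
    \sum_(j < 3 * w) link_matching b h (h + j).
  apply: sum_geq => j; rewrite /link_matching leq_min leq_divRL //.
  by have := ltn_ord j; lia.
have s2 : w * (2 * w - 2 * h) <=
    \sum_(j < w) link_matching b h (h + (3 * w + j)).
  apply: sum_geq => j; rewrite /link_matching leq_min leq_divRL //.
  by have := ltn_ord j; lia.
move: s1 s2; move: (\sum_(j < 3 * w) _) (\sum_(j < w) _) => S1 S2.
by clear; nia.
Qed.

Lemma two_bin2 n : 2 * 'C(n, 2) + n = n * n.
Proof. by elim: n => // n IHn; rewrite binS bin1; lia. Qed.

(** To leading order [m = 10 w] and [h <= w / 20], so [k >= 10.6 w^2] and [eB <= 42 w^2]. In units
    of [w^2], and apart from [kA], the left side is at most [33600 + 3200] and the right side at
    least [20000 + 16917]. *)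
Lemma near_complete_arith m w h eA eB kA k :
  10 * w <= m -> m <= 10 * w + 9 -> 200 * h <= m -> 0 < m ->
  11 * w ^ 2 <= k + 8 * w * h ->
  2 * eB + 4 * w * (4 * w) + m <= m * m + 4 * w ->
  800 * eA <= 200 * (4 * w) ^ 2 + 1596 * kA + (6 * 1000) * (4 * w) ->
  800 * (eA + eB) <= 200 * m ^ 2 + 1596 * (kA + k) + (6 * 1000) * m.
Proof.
move=> wm mw hm m_gt0; rewrite -!mulnn.
have : m * m <= 100 * (w * w) + 90 * w + 9 * m.
  have := leq_mul (leqnn m) mw; have := leq_mul (leqnn w) mw; lia.
have : 200 * (w * h) <= 10 * (w * w) + 9 * w.
  by have := leq_mul (leqnn w) (leq_trans hm mw); lia.
have -> : 8 * w * h = 8 * (w * h) by lia.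
have -> : 4 * w * (4 * w) = 16 * (w * w) by lia.
by move: (m * m) (w * w) (w * h) => mm ww wh; lia.
Qed.

(* Split W into A with about 2/5 of the m vertices and B; the star triangles over
   A inside B number about 11 m^2 / 100, and A is treated by induction.  (With
   #|A| = m / 3 the same count would give no gain over m^2 / 4.) *)
Lemma near_complete_packing E W h :
    E \subset pairs W -> proper_edge_coloring E chi ->
    {in W, forall v, #|W :\: nb E v| <= h} -> 200 * h <= #|W| -> 0 < #|W| ->
    (forall A, A \proper W -> exists Q, packing chi 3 (E :&: pairs A) Q /\
       800 * #|E :&: pairs A| <=
         200 * #|A| ^ 2 + 1596 * #|Q| + (6 * 1000) * #|A|) ->
  exists Q, packing chi 3 E Q /\
    800 * #|E| <= 200 * #|W| ^ 2 + 1596 * #|Q| + (6 * 1000) * #|W|.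
Proof.
move=> sEW prop degW leh W_gt0 IH.
pose w := #|W| %/ 10.
have wm : 10 * w <= #|W| by rewrite mulnC leq_trunc_div.
have mw : #|W| <= 10 * w + 9.
  by have := ltn_ceil #|W| (isT : 0 < 10); rewrite -/w; clear; lia.
have [A sAW cA] : exists2 A : {set T}, A \subset W & #|A| = 4 * w.
  exists [set x in take (4 * w) (enum W)].
    by apply/subsetP => x; rewrite inE => /mem_take; rewrite mem_enum.
  rewrite cardsE (card_uniqP _) ?take_uniq ?enum_uniq // size_takel // -cardE.
  by move: wm; clear; lia.
have [QA [PQA boundA]] : exists Q, packing chi 3 (E :&: pairs A) Q /\
    800 * #|E :&: pairs A| <=
      200 * #|A| ^ 2 + 1596 * #|Q| + (6 * 1000) * #|A|.
  apply: IH; rewrite properEcard sAW cA; move: wm W_gt0; clear; lia.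
pose B := W :\: A; pose E1 := E :\: pairs A.
have sE1 : E1 \subset E by apply: subsetDl.
have dAB : [disjoint A & B] by rewrite -setI_eq0 /B setDE setICA setICr setI0.
have cB : 6 * w <= #|B|.
  by rewrite cardsD (setIidPr sAW) cA; move: wm; clear; lia.
have degB : {in W, forall v, #|B :\: nb E1 v| <= h}.
  move=> v Wv; apply: leq_trans (degW v Wv).
  apply: subset_leq_card; apply/subsetP => y /setDP[/setDP[Wy Ay] nby].
  rewrite inE Wy andbT; apply: contra nby; rewrite !inE => ->.
  by rewrite subUset !sub1set (negPf Ay) andbF.
have [||Q1 [PQ1 cQ1]] := crossing_triangles (h := h) (g := h)
  (subset_trans sE1 sEW) (proper_edge_coloringS sE1 prop) dAB.
- by move=> v /(subsetP sAW); apply: degB.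
- by move=> v /setDP[Wv _]; apply: degB.
have dE : [disjoint E :&: pairs A & E1].
  by rewrite -setI_eq0 /E1 setDE setICA -!setIA setICr !setI0.
have [PQ cQ] := packingU (isT : 1 < 3) (subsetIl E (pairs A)) sE1 dE PQA PQ1.
exists (QA :|: Q1); split; first exact: PQ.
rewrite cQ -(cardsID (pairs A) E) -/E1.
have sums := link_matching_sum h cB; rewrite cA in cQ1; rewrite -cQ1 in sums.
rewrite cA in boundA; apply: near_complete_arith wm mw leh W_gt0 sums _ boundA.
have sp : E1 \subset pairs W :\: pairs A by apply: setSD.
have := subset_leq_card sp; rewrite cardsD (setIidPr (pairsS sAW)) !card_pairs cA.
have := two_bin2 #|W|; have := two_bin2 (4 * w).
have : 'C(4 * w, 2) <= 'C(#|W|, 2).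
  by apply: leq_bin2l; rewrite -cA; apply: subset_leq_card.
by clear; lia.
Qed.

(** A triangle pays for [1596 / 800 = 1.995] edges. If [s = 2 d - m], about [m / 2 + 3 s / 2] edges
    go. If [s] is about [d / 2], about [3 d / 2] go, and [3 d / 2 <= m / 2 + 1.995 d / 2] is exactly
    [201 d <= 200 m]. *)
Lemma triangle_step_arith m d s e e' k :
  0 < m -> d <= m -> 201 * d <= 200 * m ->
  s = minn (2 * d - m) (d %/ 2) -> e <= e' + d + s * 'C(2, 2) ->
  800 * e' <= 200 * m.-1 ^ 2 + 1596 * k + (6 * 1000) * m.-1 ->
  800 * e <= 200 * m ^ 2 + 1596 * (k + s) + (6 * 1000) * m.
Proof.
by case: m => // m _ ledm led defs; rewrite binn -!mulnn /=; lia.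
Qed.

Lemma triangle_packing W E : E \subset pairs W -> proper_edge_coloring E chi ->
  exists Q, packing chi 3 E Q /\
    800 * #|E| <= 200 * #|W| ^ 2 + 1596 * #|Q| + (6 * 1000) * #|W|.
Proof.
have [n] := ubnP #|W|; elim: n W E => // n IH W E /ltnSE leW sEW prop.
have [W0|W_gt0] := posnP #|W|.
  by exists set0; split; [apply: packing0|rewrite (edgeless sEW W0) muln0].
have [x Wx degW] := min_degree W_gt0 sEW.
have led := card_nb_leq x sEW.
(* In the dense case every vertex misses fewer than [#|W| / 201] vertices. Otherwise a matching in
   the neighborhood of [x] pays for the deletion of [x]. *)
have [dense|sparse] := ltnP (200 * #|W|) (201 * #|nb E x|).
  apply: (near_complete_packing sEW prop degW _ W_gt0).
    by move: led dense; clear; lia.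
  move=> A ltAW; apply: IH.
  - exact: leq_trans (proper_card ltAW) leW.
  - exact: subsetIr.
  - exact: proper_edge_coloringS (subsetIl _ _) prop.
pose s := minn (2 * #|nb E x| - #|W|) (#|nb E x| %/ 2).
have degS : {in nb E x, forall v, 2 * #|nb E x| - #|W| <= #|nb E v :&: nb E x|}.
  move=> v nbv; have := cardsID (nb E v) (nb E x).
  have := degW v (subsetP (nb_sub x sEW) v nbv).
  have := subset_leq_card (setSD (nb E v) (nb_sub x sEW)).
  by rewrite [nb E x :&: _]setIC; move: led; clear; lia.
have [||M [sM cM dM]] := matching_min_degree (s := s) sEW degS.
- exact: geq_minl.
- by apply: leq_trans (leq_trunc_div #|nb E x| 2); rewrite mulnC leq_mul2r geq_minr orbT.
have MP := matching_star_family sEW prop sM dM.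
have [Wx' cW] : #|W :\ x| < n /\ #|W :\ x| = #|W|.-1.
  by have := cardsD1 x W; rewrite Wx; move: leW W_gt0; clear; lia.
have [Q [PQ boundQ]] := IH _ _ Wx' (star_rest_pairs x M sEW)
  (proper_edge_coloringS (star_rest_sub E x M) prop).
have [Q' [PQ' cQ']] := star_packing (isT : 0 < 2) MP PQ.
exists Q'; split; first exact: PQ'.
rewrite cQ' cM; rewrite cW in boundQ.
apply: (triangle_step_arith W_gt0 led sparse (erefl s) _ boundQ).
by rewrite -cM; apply: card_star_rest sEW _ => K /(proj1 MP)[].
Qed.

End DensePacking.

(** * From the packing bound to the stability theorem *)

Lemma clique_packing q : 1 < q ->
  exists D B C0, B < D * ('C(q.+1, 2) - 1) /\
    forall (T : finType) (C : eqType) (chi : {set T} -> C)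
           (E : {set {set T}}) (W : {set T}),
      E \subset pairs W -> proper_edge_coloring E chi ->
    exists Q, packing chi q.+1 E Q /\
      2 * q * D * #|E| <= D * q.-1 * #|W| ^ 2 + 2 * q * B * #|Q| + C0 * #|W|.
Proof.
case: q => [|[|[|q]]] // _.
  (* The ratio of [B] to [D * ('C(q.+1, 2) - 1)] is the factor [lambda < 1]; for triangles it is
     [399 / 400]. *)
  exists 200, 399, (6 * 1000); split=> [//|T C chi E W sEW prop].
  have [Q [PQ bQ]] := triangle_packing sEW prop.
  by exists Q; split; [exact: PQ|lia].
exists 1, ('C(q.+3, 2)).+1, (2 * q.+4 ^ 3 + 3 * q.+3); split.
  by rewrite mul1n [in X in _ < X]binS bin1; lia.
move=> T C chi E W sEW prop.
have [Q [PQ bQ]] := clique_packing_large (isT : 1 < q.+3) sEW prop.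
by exists Q; split=> //; rewrite muln1 mul1n.
Qed.

(** Here [k] cliques with [c.+1] edges each are deleted from [e] edges, leaving [e0], and [x] is the
    deficit of [phi] from the Turán number [t]. *)
Lemma deficit_arith q D B C0 c n R e e0 k t phi x mono0 mono :
  0 < q -> B < D * c ->
  2 * q * D * e <= D * q.-1 * n ^ 2 + 2 * q * B * k + C0 * n ->
  phi + c * k <= e -> q.-1 * n ^ 2 <= 2 * q * t + q * n -> t <= phi + x ->
  e <= e0 + k * c.+1 ->
  2 * q * (e0 + mono0) <= q.-1 * n ^ 2 + 4 * q ^ 2 * (R * n) ->
  mono <= mono0 + k * c.+1 ->
  mono <= (c.+2 * D).+1 * x + (c.+2 * (D + C0) + 1 + 2 * q * R) * n.
Proof.
move=> q_gt0 ltB dense lephi turan let_ lee stab lemono.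
(* Since [B.+1 <= D * c], comparing the packing bound with [phi + c * k <= e] leaves a surplus of
   [2 * q] per clique, which the deficit must cover. *)
have lek : k <= D * x + (D + C0) * n.
  rewrite -(leq_pmul2l (_ : 0 < 2 * q)) ?muln_gt0 //.
  have h1 : 2 * q * D * (phi + c * k) <= 2 * q * D * e by rewrite leq_mul2l lephi orbT.
  have h2 : D * (q.-1 * n ^ 2) <= D * (2 * q * (phi + x) + q * n).
    rewrite leq_mul2l (leq_trans turan) ?orbT // leq_add2r.
    by rewrite leq_mul2l let_ orbT.
  have h3 : 2 * q * k * B.+1 <= 2 * q * k * (D * c) by rewrite leq_mul2l ltB orbT.
  have h4 : C0 * n <= 2 * q * (C0 * n) by rewrite leq_pmull // muln_gt0.
  move: dense h1 h2 h3 h4; rewrite -(mulnA D); move: (q.-1 * n ^ 2) => S.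
  by clear; nia.
have lem : e0 + mono0 <= phi + x + (1 + 2 * q * R) * n.
  rewrite -(leq_pmul2l (_ : 0 < 2 * q)) ?muln_gt0 //.
  apply: leq_trans stab _.
  have h2 : q.-1 * n ^ 2 <= 2 * q * (phi + x) + q * n.
    by rewrite (leq_trans turan) // leq_add2r leq_mul2l let_ orbT.
  by move: h2; rewrite -mulnn; move: (q.-1 * n ^ 2) => S; clear; nia.
(* Here [e0 >= phi - k], and restoring the cliques adds at most [c.+1] monochromatic edges each;
   together this makes [c.+2] per clique. *)
have lem' : mono <= c.+2 * k + x + (1 + 2 * q * R) * n.
  by move: lem lemono lee lephi; move: ((1 + 2 * q * R) * n) => S; clear; lia.
apply: leq_trans lem' _; have := leq_mul (leqnn c.+2) lek.
move: (2 * q * R) => S; clear; nia.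
Qed.

Lemma sum_edges_within (T : finType) (E : {set {set T}}) (q : nat) (f : T -> nat) :
    E \subset pairs [set: T] -> (forall v, f v < q) ->
  \sum_(i < q) edges_within E [set v | f v == i] <= #|mono_in E [set: T] f|.
Proof.
move=> sE ltf; rewrite /edges_within.
apply: (@leq_trans (\sum_(i < q) \sum_(e in mono_in E [set: T] f)
          (e \subset [set v | f v == i]))).
  apply: leq_sum => i _; rewrite -sum1_card big_mkcond [leqRHS]big_mkcond.
  apply: leq_sum => e _; rewrite !inE subsetT /=.
  have [Ee|//] := boolP (e \in E); have [sV|//] := boolP (e \subset _).
  have := subsetP sE e Ee; rewrite inE => /andP[_ ->] /=.
  suff -> : monochromatic f e by [].
  apply/forall_inP => x /(subsetP sV); rewrite inE => /eqP->.
  by apply/forall_inP => y /(subsetP sV); rewrite inE eq_sym.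
rewrite exchange_big /= -sum1_card; apply: leq_sum => e.
rewrite !inE => /andP[/and3P[_ _ e2] _].
have /card_gt0P[x ex] : 0 < #|e| by rewrite (eqP e2).
rewrite (bigD1 (Ordinal (ltf x))) //= big1 ?addn0 ?leq_b1 // => i neqi.
apply/eqP; rewrite eqb0; apply: contra neqi => /subsetP/(_ x ex).
by rewrite inE => /eqP eqi; apply/eqP/val_inj.
Qed.

(** A linear form of the theorem with constants depending on [q] alone. The truncated subtraction
    sets the deficit to 0 when [rainbow_phi] exceeds the Turán number. *)
Lemma rainbow_stability q : 1 < q -> exists a b, forall (T : finType)
    (C : eqType) (chi : {set T} -> C) (E : {set {set T}}),
    is_sgraph E -> proper_edge_coloring E chi ->
  exists f : T -> nat, (forall v, f v < q) /\
    \sum_(i < q) edges_within E [set v | f v == i] <=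
      a * (turan_number #|T| (complete_graph q.+1)
           - rainbow_phi E chi (complete_graph q.+1)) + b * #|T|.
Proof.
move=> q_gt1; have [D [B [C0 [ltB pack]]]] := clique_packing q_gt1.
have q_gt0 := ltnW q_gt1.
pose c := 'C(q.+1, 2) - 1.
have c1 : c.+1 = 'C(q.+1, 2) by rewrite /c subn1 prednK // bin_gt0.
exists (c.+2 * D).+1, (c.+2 * (D + C0) + 1 + 2 * q * q.+1 ^ 3).
move=> T C chi E graphE prop.
have sE : E \subset pairs [set: T].
  by apply/subsetP => e Ee; rewrite inE subsetT; apply: (forall_inP graphE).
have [Q0 [PQ0 dense0]] := pack T C chi E _ sE prop.
have [Q [PQ leQ free]] := maximal_packing (q_gt0 : 1 < q.+1) PQ0.
set U := \bigcup_(K in Q) pairs K in free.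
have sE0 : E :\: U \subset E by apply: subsetDl.
have [f [ltf stab]] := rainbow_free_stability q_gt0 (subset_trans sE0 sE)
  (proper_edge_coloringS sE0 prop) free.
exists f; split=> //; apply: leq_trans (sum_edges_within sE ltf) _.
have cU : #|U| <= #|Q| * c.+1.
  by rewrite c1; apply: card_cover_pairs => K /(proj1 PQ)[].
rewrite cardsT in dense0 stab.
have dense : 2 * q * D * #|E| <=
    D * q.-1 * #|T| ^ 2 + 2 * q * B * #|Q| + C0 * #|T|.
  by apply: leq_trans dense0 _; rewrite leq_add2r leq_add2l leq_mul2l leQ orbT.
have lephi := phi_packing (q_gt0 : 1 < q.+1) PQ.
apply: deficit_arith q_gt0 ltB dense lephi (turan_lower _ q_gt0) _ _ stab _.
- by rewrite -leq_subLR.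
- have := cardsID U E; have := subset_leq_card (subsetIr E U).
  by move: cU; clear; lia.
(* A monochromatic edge either survives the deletion or lies in the deleted set [U]. *)
apply: leq_trans (leq_add (leqnn _) cU); apply: leq_trans (leq_card_setU _ _).
apply: subset_leq_card; apply/subsetP => e; rewrite !inE => /andP[/andP[-> ->] ->].
by rewrite !andbT orNb.
Qed.

Local Open Scope ring_scope.

Theorem theorem12 (R : realType) (r : nat) (hr : (3 <= r)%N)
    (gamma : R) (hgamma : 0 < gamma) :
  exists (eps : R) (n0 : nat), 0 < eps /\
    forall (n : nat) (T : finType) (E : {set {set T}})
           (C : eqType) (chi : {set T} -> C),
      #|T| = n -> (n0 <= n)%N ->
      is_sgraph E -> proper_edge_coloring E chi ->
      (turan_number n (complete_graph r))%:R - eps * n%:R ^+ 2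
        <= (rainbow_phi E chi (complete_graph r))%:R ->
      exists V : 'I_r.-1 -> {set T},
        vertex_partition V /\
        (\sum_(i < r.-1) edges_within E (V i))%N%:R < gamma * n%:R ^+ 2.
Proof.
case: r hr => // q hq; have [a [b stab]] := rainbow_stability hq.
have a_gt0 : 0 < (a.+1)%:R :> R by rewrite ltr0n.
(* Half of [gamma] absorbs [a] times the deficit, with [a.+1] keeping the divisor positive; the
   other half absorbs [b * n] once [n] exceeds [2 b / gamma]. *)
exists (gamma / 2 / a.+1%:R), (Num.bound (b%:R / (gamma / 2))).+1.
have g2 : 0 < gamma / 2 by rewrite divr_gt0.
have eps_gt0 : 0 < gamma / 2 / a.+1%:R by rewrite divr_gt0.
split=> // n T E C chi cT len graphE prop; set t := turan_number _ _.
set phi := rainbow_phi _ _ _ => close.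
have [f [ltf]] := stab T C chi E graphE prop; rewrite cT -/t -/phi => bound.
exists (fun i : 'I_q => [set v | f v == i]); split.
  split=> [|i j neq_ij].
    apply/setP => v; rewrite inE; apply/bigcupP.
    by exists (Ordinal (ltf v)); rewrite // inE.
  rewrite -setI_eq0; apply/eqP/setP => v; rewrite !inE; apply/negP.
  by move=> /andP[/eqP-> /eqP eqij]; case/eqP: neq_ij; apply/val_inj.
have n_gt0 : 0 < n%:R :> R by rewrite ltr0n (leq_trans _ len).
have le_bound : (b%:R : R) < gamma / 2 * n%:R.
  rewrite mulrC -ltr_pdivrMr //; apply: lt_le_trans (archi_boundP _) _.
    by rewrite divr_ge0 // ltW.
  by rewrite ler_nat ltnW.
have le_x : (t - phi)%N%:R <= gamma / 2 / a.+1%:R * n%:R ^+ 2.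
  have [letphi|ltphi] := leqP t phi.
    by rewrite (eqP (letphi : (t - phi == 0)%N)) mulr_ge0 ?exprn_ge0 ?ltW.
  by rewrite natrB ?(ltnW ltphi) // lerBlDr -lerBlDl.
have le_ax : (a%:R : R) * (t - phi)%N%:R <= gamma / 2 * n%:R ^+ 2.
  apply: (@le_trans _ _ (a.+1%:R * (t - phi)%N%:R)).
    by rewrite ler_wpM2r // ler_nat.
  apply: le_trans (ler_wpM2l (ltW a_gt0) le_x) _.
  by rewrite mulrA [a.+1%:R * _]mulrC divfK // gt_eqF.
apply: (@le_lt_trans _ _ ((a * (t - phi) + b * n)%N%:R)); first by rewrite ler_nat.
rewrite natrD !natrM [X in _ < X * _]splitr mulrDl; apply: ler_ltD => //.
by rewrite expr2 mulrA ltr_pM2r.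
Qed.
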